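(* Let $k,n$ be integers with $3\le k\le n$. Let $e_1,\ldots,e_n$ be the standard unit vectors of order $n\times 1$, and define vectors $b_1,\ldots,b_n$ recursively by $$b_1=e_1,\qquad b_r=e_r+b_{r-1}\ (r=2,\ldots,k-1),\qquad b_r=e_r+\sum_{u=1}^{k-1}b_{r-u}\ (r=k,\ldots,n).$$ Define $\beta_1,\ldots,\beta_n$ by $\sum_{r=1}^n b_r=(\beta_1,\ldots,\beta_n)'$, where the prime denotes transpose. Suppose a stick is broken at random at $n-1$ points to form $n$ pieces. Then the probability $P(k,n)$ that no choice of $k$ pieces out of the $n$ pieces forms a $k$-gon is $$P(k,n)=\frac{n!}{\prod_{r=1}^n\beta_r}.$$
   Context: The stick is taken, without loss of generality, to have length 1. ''Broken at random at $n-1$ points'' means that the $n-1$ breaking points are independent and uniformly distributed on the stick; the $n$ pieces are the resulting consecutive segments. A set of $k$ pieces forms a $k$-gon if and only if the length of the longest of these pieces is less than the sum of the lengths of the other $k-1$ pieces (ties occur with probability zero). *)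

(* Defs.v *)
From HB Require Import structures.
From mathcomp Require Import all_boot all_order all_algebra.
From mathcomp Require Import all_classical all_reals all_analysis.
Set Implicit Arguments.
Unset Strict Implicit.
Unset Printing Implicit Defensive.
Import Order.TTheory GRing.Theory Num.Theory.
Local Open Scope classical_set_scope.
Local Open Scope ring_scope.

(* 1-based: [unit_vec R n r] is e_r for 1 <= r <= n, while the coordinates of
   'cV[R]_n are numbered from 0. *)
Definition unit_vec (R : realType) (n r : nat) : 'cV[R]_n :=
  \col_(i < n) (i.+1 == r)%:R.

Definition mutually_independent (d : measure_display) (T : measurableType d)
    (R : realType) (P : probability T R) (I : finType)
    (X : I -> {RV P >-> R}) : Prop :=
  forall (J : {set I}) (A : I -> set R),
    (forall i, measurable (A i)) ->
    P [set w | forall i, i \in J -> A i (X i w)] =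
      (\prod_(i in J) P (X i @^-1` A i))%E.

Definition uniform01 (d : measure_display) (T : measurableType d)
    (R : realType) (P : probability T R) (X : {RV P >-> R}) : Prop :=
  forall A : set R, measurable A ->
    distribution P X A = uniform_prob (@ltr01 R) A.

(* The stick is [0, 1], broken at the points x i.  With s the increasing
   rearrangement of these m points, piece j (0 <= j <= m, numbered from the
   left) lies between entries j and j.+1 of the sequence 0 :: rcons s 1. *)
Definition piece_length (R : realType) (m : nat) (x : 'I_m -> R) (j : nat) : R :=
  let s := sort <=%O [seq x i | i <- enum 'I_m] in
  nth 0 (rcons s 1) j - nth 0 (0 :: s) j.

(* The choice of j among several longest pieces does not matter. *)
Definition forms_polygon (R : realType) (n : nat) (len : 'I_n -> R)
    (A : {set 'I_n}) : Prop :=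
  exists j : 'I_n,
    [/\ j \in A,
        forall i, i \in A -> len i <= len j &
        len j < \sum_(i in A | i != j) len i].

(* Main.v *)
Require Import Defs.
From HB Require Import structures.
From mathcomp Require Import all_boot all_order perm all_algebra.
From mathcomp Require Import all_classical all_reals all_analysis.
From mathcomp Require Import measurable_realfun ring lra zify.
Set Implicit Arguments.
Unset Strict Implicit.
Unset Printing Implicit Defensive.
Import Order.TTheory GRing.Theory Num.Theory.
Local Open Scope ring_scope.

(** Sort the [n] pieces into [z_1 <= ... <= z_n].  In a set of [k] pieces whose
    longest one is [z_r], the other [k - 1] pieces come before [z_r], and their
    sum is largest when they are its immediate predecessors.  Hence no [k]-gon
    exists iff [z_r >= z_(r-1) + ... + z_(r-k+1)] for all [r >= k].  Let [a_r]
    be the slack in this inequality when [r >= k], and [z_r - z_(r-1)] when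
    [r < k], where [z_0 = 0].  Then [z] is recovered from [a >= 0] by a linear recurrence, the
    vectors [b_r] are the coefficient vectors of its solution, and
    [z_1 + ... + z_n = 1] becomes [beta_1 a_1 + ... + beta_n a_n = 1].  This
    simplex has [1 / (beta_1 ... beta_n)] times the volume of the standard one,
    and the [n!] orders of the pieces account for the factor [n!].

    Volumes are compared by counting lattice points.  Cut each axis of the cube
    [[0, 1]^(n-1)] into [N] equal intervals; by independence every cell of the
    resulting grid has probability [N^-(n-1)].  A cell is described by the order
    [p] of the breaking points, the order [q] of the pieces and an integer
    vector [a] with [beta_1 a_1 + ... + beta_n a_n = N] ([grid_point]).
    Rounding to the grid changes the length of a piece by less than one unit,
    hence each slack by less than [k] units.  So the configurations without
    [k]-gon are covered by the cells with [a_i >= -k] ([grid_cover]), while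
    every cell with [a_i >= k] consists of such configurations
    ([no_polygon_in_cell]), and distinct triples [(p, q, a)] of the latter kind
    give distinct cells ([grid_point_inj]).  After translating [a] by [k], both
    bounds count the solutions [h] in natural numbers of
    [beta_1 h_1 + ... + beta_n h_n = M] with [M - N] bounded.  As [beta_n = 1],
    there are about [M^(n-1) / ((n-1)! beta_1 ... beta_n)] of them
    ([weighted_sols_bounds]).  Multiplying by the [(n-1)! n!] pairs [(p, q)] and
    by [N^-(n-1)], and letting [N] tend to infinity ([ratio_squeeze]), gives the
    formula. *)

(** * Linear recurrences with a moving window *)

Section Recurrence.
Variable lo : nat -> nat.

(** Course-of-values recursion: the list of the first [n] terms is carried
    along, so that every term may refer to all the earlier ones. *)
Fixpoint window_prefix (V : zmodType) (a : nat -> V) (n : nat) : seq V :=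
  if n is n'.+1 then
    let s := window_prefix a n' in
    rcons s (a n' + \sum_(lo n' <= i < n') nth 0 s i)
  else [::].

Definition window_seq (V : zmodType) (a : nat -> V) (r : nat) : V :=
  nth 0 (window_prefix a r.+1) r.

Lemma size_window_prefix (V : zmodType) (a : nat -> V) n :
  size (window_prefix a n) = n.
Proof. by elim: n => //= n IH; rewrite size_rcons IH. Qed.

Lemma nth_window_prefix (V : zmodType) (a : nat -> V) n r :
  (r < n)%N -> nth 0 (window_prefix a n) r = window_seq a r.
Proof.
elim: n => // n IH; rewrite ltnS leq_eqVlt => /orP[/eqP-> //|rn].
by rewrite /= nth_rcons size_window_prefix rn IH.
Qed.

Lemma window_seqE (V : zmodType) (a : nat -> V) r :
  window_seq a r = a r + \sum_(lo r <= i < r) window_seq a i.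
Proof.
rewrite {1}/window_seq /= nth_rcons size_window_prefix ltnn eqxx; congr (_ + _).
by apply: eq_big_nat => i /andP[_ ir]; rewrite nth_window_prefix.
Qed.

Lemma window_seq_uniq (V : zmodType) (a q : nat -> V) n :
  (forall r, (r < n)%N -> q r = a r + \sum_(lo r <= i < r) q i) ->
  forall r, (r < n)%N -> q r = window_seq a r.
Proof.
move=> qE; elim/ltn_ind => r IH rn; rewrite qE// window_seqE; congr (_ + _).
by apply: eq_big_nat => i /andP[_ ir]; apply: IH => //; exact: ltn_trans rn.
Qed.

(** The recurrence has integer coefficients, so additive maps commute with
    solving it.  This relates the vectors [b_r], their coordinates and the
    integer coefficients used for counting. *)
Lemma raddf_window_seq (V W : zmodType) (f : {additive V -> W})
    (a : nat -> V) r :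
  f (window_seq a r) = window_seq (f \o a) r.
Proof.
apply: (@window_seq_uniq _ _ (f \o window_seq a) r.+1) => // i _ /=.
by rewrite window_seqE raddfD raddf_sum.
Qed.

Definition window_unit (i r : nat) : int :=
  window_seq (fun j => (j == i)%:R : int) r.

(** This is [beta_i] for [n] terms.  The terms are nonnegative, so [absz] only
    turns the sum into a natural number. *)
Definition window_weight (n i : nat) : nat :=
  absz (\sum_(r < n) window_unit i r).

Lemma window_unit_ge0 i r : 0 <= window_unit i r.
Proof.
rewrite /window_unit; elim/ltn_ind: r => r IH; rewrite window_seqE.
by rewrite addr_ge0 ?ler0n// big_nat sumr_ge0// => j /andP[_]; exact: IH.
Qed.

Lemma window_weightE n i :
  (window_weight n i)%:Z = \sum_(r < n) window_unit i r.
Proof. by rewrite gez0_abs// sumr_ge0// => r _; exact: window_unit_ge0. Qed.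

Lemma window_seq_unit (a : nat -> int) n r : (r < n)%N ->
  window_seq a r = \sum_(i < n) window_unit i r * a i.
Proof.
move=> rn; apply/esym; move: r rn; apply: window_seq_uniq => r rn.
under eq_bigr => i _ do rewrite /window_unit window_seqE mulrDl.
rewrite big_split /= (bigD1 (Ordinal rn))//= eqxx mul1r big1 ?addr0; last first.
  move=> i /eqP ir; rewrite [_ == _]negbTE ?mul0r//.
  by apply/eqP => ri; apply: ir; apply: val_inj.
congr (_ + _); rewrite exchange_big/=; apply: eq_bigr => i _.
by rewrite mulr_suml.
Qed.

(** Linearity turns the constraint that the lengths add up to the whole stick
    into a weighted sum of the inputs. *)
Lemma sum_window_seq (a : nat -> int) n :
  \sum_(r < n) window_seq a r = \sum_(i < n) (window_weight n i)%:Z * a i.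
Proof.
under eq_bigr => r _ do rewrite (window_seq_unit _ (ltn_ord r)).
rewrite exchange_big/=; apply: eq_bigr => i _.
by rewrite window_weightE mulr_suml.
Qed.

Lemma window_unit_lt i r : (r < i)%N -> window_unit i r = 0.
Proof.
rewrite /window_unit; elim/ltn_ind: r => r IH ri; rewrite window_seqE.
rewrite ltn_eqF// add0r big_nat big1// => j /andP[_ jr].
by rewrite IH// (ltn_trans jr).
Qed.

Lemma window_unit_diag i : window_unit i i = 1.
Proof.
rewrite /window_unit window_seqE eqxx big_nat big1 ?addr0// => j /andP[_].
exact: window_unit_lt.
Qed.

Lemma window_weight_gt0 n i : (i < n)%N -> (0 < window_weight n i)%N.
Proof.
move=> ilt; rewrite -ltz_nat window_weightE (bigD1 (Ordinal ilt))//=.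
rewrite window_unit_diag ltr_pwDl// sumr_ge0// => r _; exact: window_unit_ge0.
Qed.

(** The last input enters the last term only.  This makes the weighted equation
    always solvable for its last unknown, which the count relies on. *)
Lemma window_weight_last m : window_weight m.+1 m = 1%N.
Proof.
apply/eqP; rewrite -eqz_nat window_weightE big_ord_recr/= window_unit_diag.
by rewrite big1 ?add0r// => i _; exact: window_unit_lt.
Qed.

Lemma window_seq_ge0 (a : nat -> int) r : (forall i, 0 <= a i) ->
  0 <= window_seq a r.
Proof.
move=> a0; elim/ltn_ind: r => r IH; rewrite window_seqE addr_ge0//.
by rewrite big_nat sumr_ge0// => j /andP[_]; exact: IH.
Qed.

Lemma window_seq_lt (a : nat -> int) (c : int) r : (0 < c) ->
  (forall i, c <= a i) -> (lo r.+1 <= r)%N ->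
  window_seq a r + c <= window_seq a r.+1.
Proof.
move=> c0 ac lor; have a0 i : 0 <= a i by rewrite (le_trans (ltW c0)).
rewrite [X in _ <= X]window_seqE big_nat_recr//= addrA [X in _ <= X]addrC.
rewrite lerD2l (le_trans (ac r.+1))// lerDl big_nat sumr_ge0// => j _.
exact: window_seq_ge0.
Qed.

End Recurrence.

(** * Counting solutions of a weighted sum *)

(** The list of all [h] with [sum_i bs_i h_i = M]; having it as a duplicate-free
    list gives a recursion for its length. *)
Fixpoint weighted_sols (bs : seq nat) (M : nat) : seq (seq nat) :=
  if bs is b :: bs' then
    [seq t :: h | t <- iota 0 (M %/ b).+1, h <- weighted_sols bs' (M - b * t)]
  else if M == 0%N then [:: [::]] else [::].

Lemma mem_weighted_sols bs M h : all (leq 1) bs ->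
  (h \in weighted_sols bs M) =
    (size h == size bs) && (\sum_(i < size bs) nth 0 bs i * nth 0 h i == M)%N.
Proof.
elim: bs M h => [|b bs IH] M h.
  move=> _ /=; rewrite big_ord0 eq_sym; case: ifP => _; last by rewrite andbF.
  by rewrite inE andbT; case: h.
case/andP=> b0 bs0; apply/allpairsPdep/idP => [[t [h' [tM h'M ->]]]|].
  rewrite mem_iota add0n ltnS leq_divRL// in tM.
  rewrite IH// in h'M; case/andP: h'M => /eqP sh /eqP sM.
  by rewrite /= sh eqxx big_ord_recl/= sM mulnC subnKC// mulnC.
case: h => [//|t h]; rewrite [size _ == _]eqSS [size (b :: bs)]/= big_ord_recl.
move=> /andP[sh /eqP sM].
exists t, h; split => //; last by rewrite IH// sh /= -sM addKn eqxx.
by rewrite mem_iota /= add0n ltnS leq_divRL// -sM mulnC leq_addr.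
Qed.

Lemma uniq_weighted_sols bs M : uniq (weighted_sols bs M).
Proof.
elim: bs M => [|b bs IH] M; first by rewrite /=; case: ifP.
apply: allpairs_uniq_dep => //; first exact: iota_uniq.
by move=> [t h] [t' h'] _ _ /= [-> ->].
Qed.

Lemma size_weighted_sols1 M : size (weighted_sols [:: 1%N] M) = 1%N.
Proof.
have u := uniq_weighted_sols [:: 1%N] M.
have : perm_eq (weighted_sols [:: 1%N] M) [:: [:: M]].
  apply: uniq_perm => // h; rewrite mem_weighted_sols// inE /=.
  rewrite big_ord_recl big_ord0 /= mul1n addn0.
  by case: h => [//|x [|y h]]; rewrite /= ?eqseq_cons ?andbT// andbF.
exact: perm_size.
Qed.

Lemma size_weighted_solsS b bs M :
  size (weighted_sols (b :: bs) M) =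
  \sum_(t < (M %/ b).+1) size (weighted_sols bs (M - b * t)).
Proof.
rewrite size_allpairs_dep sumnE big_map.
rewrite -(big_mkord xpredT (fun t => size (weighted_sols bs (M - b * t)))).
by rewrite /index_iota subn0.
Qed.

Lemma leq_exp_tangent j b a :
  ((a + b) ^ j.+1 <= a ^ j.+1 + j.+1 * (b * (a + b) ^ j))%N.
Proof.
elim: j => [|j IH]; first by rewrite !expn1 expn0 muln1 mul1n.
rewrite expnS (leq_trans (leq_mul (leqnn _) IH))// mulnDr.
rewrite [X in (_ + X <= _)%N](_ : _ = j.+1 * (b * (a + b) ^ j.+1))%N; last first.
  by rewrite [in RHS]expnS; ring.
rewrite mulnDl -expnS -addnA leq_add2l mulSn [X in (_ <= X)%N]addnC.
by rewrite addnC leq_add2l leq_mul2l leq_exp2r// leq_addr orbT.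
Qed.

Lemma leq_tangent_exp j b a :
  (a ^ j.+1 + j.+1 * (b * a ^ j) <= (a + b) ^ j.+1)%N.
Proof.
elim: j => [|j IH]; first by rewrite !expn1 expn0 muln1 mul1n.
rewrite [X in (_ <= X)%N]expnS (leq_trans _ (leq_mul (leqnn _) IH))//.
rewrite mulnDr [X in (_ <= _ + X)%N](_ : _ = j.+1 * (b * (a + b) * a ^ j))%N.
  by rewrite mulnDl -expnS -addnA leq_add2l mulSn leq_add2l expnS; nia.
by ring.
Qed.

(** Each summand is the area of a rectangle of width [b] below the graph of
    [x |-> (j + 1) x^j], so both this bound and the next one compare a Riemann
    sum with the integral. *)
Lemma sum_powers_le j b u n :
  (\sum_(t < n) j.+1 * (b * (u + b * t) ^ j) <= (u + b * n) ^ j.+1)%N.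
Proof.
elim: n => [|n IH]; first by rewrite big_ord0.
rewrite big_ord_recr/= (leq_trans (leq_add IH (leqnn _)))//.
by rewrite mulnSr addnA leq_tangent_exp.
Qed.

Lemma sum_powers_ge j b u n : (u <= b)%N ->
  ((u + b * n) ^ j.+1 <= \sum_(t < n.+1) j.+1 * (b * (u + b * t) ^ j))%N.
Proof.
move=> ub; elim: n => [|n IH].
  rewrite big_ord1 !muln0 addn0 expnS (@leq_trans (b * u ^ j))//.
    by rewrite leq_mul.
  by rewrite leq_pmull.
rewrite big_ord_recr/= (leq_trans _ (leq_add IH (leqnn _)))//.
by rewrite mulnSr addnA leq_exp_tangent.
Qed.

(** The weight [1] at the end leaves one free solution for each choice of the
    other unknowns, subject to [sum bs_i h_i <= M]: these are the lattice points
    of a simplex of volume [M^j / (j! prod bs)].  By induction on the dimension,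
    slicing along the first unknown. *)
Lemma weighted_sols_bounds bs M : all (leq 1) bs ->
  (M ^ size bs <=
     (size bs)`! * \prod_(b <- bs) b * size (weighted_sols (rcons bs 1) M) <=
   (M + \sum_(b <- bs) b) ^ size bs)%N.
Proof.
elim: bs M => [|b bs IH] M.
  by move=> _; rewrite [rcons _ _]/= size_weighted_sols1 !big_nil.
case/andP=> b0 bs0; rewrite [rcons _ _]/= size_weighted_solsS !big_cons factS.
set j := size bs; set p := (\prod_(_ <- _) _)%N; set s := (\sum_(_ <- _) _)%N.
rewrite (_ : _ * _ * _ = \sum_(t < (M %/ b).+1) j.+1 * (b *
    (j`! * p * size (weighted_sols (rcons bs 1) (M %% b + b * t)))))%N; last first.
  (* reversed, the remaining totals start at the remainder and go up by b *)
  rewrite (reindex_inj rev_ord_inj)/= big_distrr/=; apply: eq_bigr => t _.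
  have -> : (M - b * ((M %/ b).+1 - t.+1) = M %% b + b * t)%N.
    rewrite subSS mulnBr subnBA ?leq_mul2l ?(leq_ord t) ?orbT//.
    have := divn_eq M b; rewrite [(_ %/ _ * _)%N]mulnC.
    by set x := (b * _)%N => {1}->; rewrite -addnA addKn.
  by rewrite !mulnA; congr (_ * _)%N; ring.
have -> : size (b :: bs) = j.+1 by [].
apply/andP; split.
  rewrite {1}(divn_eq M b) addnC mulnC.
  rewrite (leq_trans (sum_powers_ge _ _ (ltnW (ltn_pmod M b0))))//.
  apply: leq_sum => t _; rewrite !leq_mul2l; apply/orP; right; apply/orP; right.
  by case/andP: (IH (M %% b + b * t)%N bs0).
rewrite (@leq_trans ((M %% b + s + b * (M %/ b).+1) ^ j.+1))%N//; last first.
  rewrite leq_exp2r//; move: (divn_eq M b).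
  by move: (M %/ b)%N (M %% b)%N => q r ->; rewrite mulnS; nia.
rewrite (leq_trans _ (sum_powers_le _ _ _ _))//.
apply: leq_sum => t _; rewrite !leq_mul2l; apply/orP; right; apply/orP; right.
by rewrite addnAC; case/andP: (IH (M %% b + b * t)%N bs0).
Qed.

(** * Sorted lengths and polygons *)

Lemma sum_ord_window (V : nmodType) (F : nat -> V) n a b : (b <= n)%N ->
  \sum_(i < n | (a <= i < b)%N) F i = \sum_(a <= i < b) F i.
Proof.
move=> bn; rewrite (big_nat_widen _ _ _ _ _ bn) (big_nat_widenl _ 0)//.
by rewrite big_mkord; apply: eq_bigl => i; rewrite andbC.
Qed.

Lemma card_ord_window n a b : (b <= n)%N ->
  #|[set i : 'I_n | (a <= i < b)%N]| = (b - a)%N.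
Proof.
move=> bn; rewrite -sum1_card -[RHS]muln1 -sum_nat_const_nat.
by rewrite -(sum_ord_window (fun=> 1%N) a bn); apply: eq_bigl => i; rewrite inE.
Qed.

(** For a nondecreasing [F] the largest sum over a set of given size is that
    over the last indices.  With [F lo] subtracted, terms in the window but not
    in [B] are nonnegative, and terms in [B] but not in the window nonpositive. *)
Lemma sum_set_le_window (R : realDomainType) (F : nat -> R) n r (B : {set 'I_n}) :
  (r <= n)%N -> (forall i j, (i <= j < r)%N -> F i <= F j) ->
  (forall b, b \in B -> (b < r)%N) ->
  \sum_(b in B) F b <= \sum_(r - #|B| <= i < r) F i.
Proof.
move=> rn Fmono Br; set lo := (r - #|B|)%N.
have Br_card : (#|B| <= r)%N.
  rewrite -[r]subn0 -(card_ord_window 0 rn) subset_leq_card//.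
  by apply/fintype.subsetP => b bB; rewrite inE Br.
pose J := [set i : 'I_n | (lo <= i < r)%N].
have cJ : #|J| = #|B| by rewrite card_ord_window// /lo subKn.
rewrite -(sum_ord_window _ _ rn) [leRHS](eq_bigl (fun i => i \in J)); last first.
  by move=> i; rewrite inE.
rewrite -(lerD2r (- (F lo *+ #|B|))) -{2}cJ -!sumr_const -!sumrB.
rewrite big_mkcond [leRHS]big_mkcond/=; apply: ler_sum => i _.
case: ifPn => [iB|_]; last first.
  by case: ifP => //; rewrite inE subr_ge0 => ?; exact: Fmono.
have lor : (lo < r)%N.
  rewrite /lo ltn_subrL (leq_ltn_trans _ (Br _ iB))// andbT.
  by apply/card_gt0P; exists i.
rewrite inE Br// andbT; case: leqP => // ilo.
by rewrite subr_le0 Fmono// lor (ltnW ilo).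
Qed.

Section Polygons.
Variables (R : realType) (n k : nat) (z : 'I_n -> R) (zb : nat -> R) (p : 'S_n).
Hypothesis k0 : (0 < k)%N.
Hypothesis zE : forall j, z j = zb (p j).

(** The witness is the set of the pieces of ranks [r - k + 1, ..., r]: its
    longest piece has rank [r]. *)
Lemma window_le_of_no_polygon :
  (forall i j, (i <= j < n)%N -> zb i <= zb j) ->
  (forall A : {set 'I_n}, #|A| = k -> ~ forms_polygon z A) ->
  forall r, (k.-1 <= r < n)%N -> \sum_(r - k.-1 <= i < r) zb i <= zb r.
Proof.
move=> mono nopoly r /andP[kr rn]; rewrite leNgt; apply/negP => lt_r.
pose A := [set j : 'I_n | (r - k.-1 <= p j < r.+1)%N].
have sumA (V : nmodType) (F : nat -> V) (P : pred nat) :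
    \sum_(j in A | P (p j)) F (p j) =
    \sum_(i < n | (r - k.-1 <= i < r.+1)%N && P i) F i.
  rewrite [RHS](reindex_inj (@perm_inj _ p))/=.
  by apply: eq_bigl => j; rewrite inE.
apply: (nopoly A).
  rewrite -sum1_card (eq_bigl (fun j => (j \in A) && true)); last first.
    by move=> j; rewrite andbT.
  rewrite (sumA nat (fun=> 1%N) xpredT); under eq_bigl do rewrite andbT.
  rewrite (sum_ord_window (fun=> 1%N))// sum_nat_const_nat muln1 subSn ?leq_subr//.
  by rewrite subKn// prednK.
exists ((p^-1)%g (Ordinal rn)); split.
- by rewrite inE permKV /= leq_subr ltnSn.
- move=> i; rewrite inE !zE permKV /= ltnS => /andP[_ ir].
  by rewrite mono// ir.
- rewrite zE permKV /=; apply: lt_le_trans lt_r _.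
  rewrite -(sum_ord_window zb (r - k.-1) (ltnW rn)).
  rewrite [leRHS](eq_bigr (fun i => zb (p i))); last by move=> i _; rewrite zE.
  rewrite [leRHS](eq_bigl (fun i => (i \in A) && (p i != r :> nat))); last first.
    move=> i; congr (_ && _). congr (~~ _); apply/eqP/eqP => [->|e].
      by rewrite permKV.
    by apply: (@perm_inj _ p); rewrite permKV; apply: val_inj.
  rewrite (sumA _ zb (fun i => i != r)) le_eqVlt; apply/orP; left; apply/eqP.
  by apply: eq_bigl => i; rewrite ltnS -andbA; congr (_ && _); rewrite andbC -ltn_neqAle.
Qed.

(** In a [k]-set whose longest piece has rank [r], the other pieces have smaller
    ranks, so their sum is at most that of the [k - 1] ranks below [r].  Strict
    monotonicity rules out ties for the longest piece, which would allow ranks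
    above [r]. *)
Lemma no_polygon_of_window_le :
  (forall i j, (i < j < n)%N -> zb i < zb j) ->
  (forall r, (k.-1 <= r < n)%N -> \sum_(r - k.-1 <= i < r) zb i <= zb r) ->
  forall A : {set 'I_n}, #|A| = k -> ~ forms_polygon z A.
Proof.
move=> mono winle A cA [j [jA jmax]]; apply/negP; rewrite -leNgt.
have lt_j i : i \in A :\ j -> (p i < p j)%N.
  rewrite !inE => /andP[ij iA]; rewrite ltnNge; apply/negP => ji.
  have := jmax i iA; rewrite !zE leNgt => /negP; apply; apply: mono.
  rewrite ltn_ord andbT ltn_neqAle ji andbT; apply: contra ij => /eqP e.
  by apply/eqP; apply: (@perm_inj _ p); apply: val_inj.
pose B := [set p i | i in A :\ j].
have Blt b : b \in B -> (b < p j)%N by case/imsetP => i /lt_j ? ->.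
have cB : #|B| = k.-1.
  by rewrite card_imset; [rewrite -cA (cardsD1 j A) jA | exact: perm_inj].
have monow i i' : (i <= i' < p j)%N -> zb i <= zb i'.
  case/andP; rewrite leq_eqVlt => /orP[/eqP->//|ii' i'j].
  by rewrite ltW// mono// ii' (ltn_trans i'j).
rewrite (eq_bigl (fun i => i \in A :\ j)); last by move=> i; rewrite !inE andbC.
rewrite (eq_bigr (fun i => zb (p i))); last by move=> i _; rewrite zE.
rewrite -(big_imset (fun b : 'I_n => zb b))/=; last by move=> ? ? _ _ /perm_inj.
rewrite zE (le_trans (sum_set_le_window (ltnW (ltn_ord (p j))) monow Blt))//.
rewrite cB winle// ltn_ord andbT -cB -[leqRHS]subn0.
rewrite -(card_ord_window 0 (ltnW (ltn_ord (p j)))) subset_leq_card//.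
by apply/fintype.subsetP => b bB; rewrite inE Blt.
Qed.

End Polygons.

(** * Order statistics and lengths of pieces *)

Section OrderStatistics.
Variables (R : realType) (m : nat).
Implicit Types (x : 'I_m -> R).

Definition order_stat x (j : nat) : R :=
  nth 0 (sort <=%O [seq x i | i <- enum 'I_m]) j.

Lemma size_sort_values x : size (sort <=%O [seq x i | i <- enum 'I_m]) = m.
Proof. by rewrite size_sort size_map size_enum_ord. Qed.

Lemma order_stat_perm x : exists s : 'S_m, forall i, x i = order_stat x (s i).
Proof.
have/tuple_permP[s xs] : perm_eq [seq x i | i <- enum 'I_m]
    (Tuple (introT eqP (size_sort_values x))).
  by rewrite perm_sym /= perm_sort.
exists s => i; have := congr1 (fun u => nth 0 u i) xs.
rewrite (nth_map i) ?size_enum_ord// nth_ord_enum => ->.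
by rewrite /= (nth_map i) ?size_enum_ord// nth_ord_enum (tnth_nth 0).
Qed.

Lemma order_stat_homo x i j : (i <= j < m)%N -> order_stat x i <= order_stat x j.
Proof.
case/andP=> ij jm; apply: sorted_leq_nth => //.
- exact: le_trans.
- by apply: sort_sorted; exact: le_total.
- by rewrite inE size_sort_values (leq_ltn_trans ij).
- by rewrite inE size_sort_values.
Qed.

Lemma order_stat_unique x (s : 'I_m -> R) (p : 'S_m) :
  (forall i j : 'I_m, (i < j)%N -> s i < s j) -> (forall i, x i = s (p i)) ->
  forall j : 'I_m, order_stat x j = s j.
Proof.
move=> smono xE j; rewrite /order_stat.
suff -> : sort <=%O [seq x i | i <- enum 'I_m] = [seq s i | i <- enum 'I_m].
  by rewrite (nth_map j) ?size_enum_ord// nth_ord_enum.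
apply: (@sorted_eq _ <=%O); first exact: le_trans.
- exact: le_anti.
- by apply: sort_sorted; exact: le_total.
- rewrite sorted_map; apply: (@sub_sorted _ (relpre val ltn)).
    by move=> i i' /= /smono/ltW.
  by rewrite -sorted_map val_enum_ord iota_ltn_sorted.
- rewrite perm_sort.
  rewrite (eq_map xE) (map_comp s p); apply: perm_map.
  apply: uniq_perm; last first.
  - move=> i; rewrite mem_enum; apply/mapP.
    by exists ((p^-1)%g i); rewrite ?mem_enum// permKV.
  - exact: enum_uniq.
  - by rewrite map_inj_uniq ?enum_uniq//; exact: perm_inj.
Qed.

Lemma piece_lengthE x j : (j <= m)%N -> piece_length x j =
  (if (j < m)%N then order_stat x j else 1) -
  (if j is j'.+1 then order_stat x j' else 0).
Proof.
move=> jm; rewrite /piece_length nth_rcons size_sort_values.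
rewrite (_ : (j == m) = ~~ (j < m)%N); last by rewrite ltn_neqAle jm andbT negbK.
by congr (_ - _); [case: ltnP | case: j {jm}].
Qed.

Lemma piece_length_ge0 x j : (j <= m)%N -> (forall i, 0 <= x i <= 1) ->
  0 <= piece_length x j.
Proof.
move=> jm x01; rewrite piece_lengthE// subr_ge0.
have os01 i : (i < m)%N -> 0 <= order_stat x i <= 1.
  move=> im; have [s xs] := order_stat_perm x.
  by have := x01 ((s^-1)%g (Ordinal im)); rewrite xs permKV.
case: j jm => [|j] jm; case: ifP => // jm'.
- by case/andP: (os01 _ jm').
- by rewrite order_stat_homo// leqnSn.
- by case/andP: (os01 _ jm).
Qed.

(** If [t] rounds down [N] times the ordered breaking points, including the
    endpoints [0] and [1], the two rounding errors in the difference of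
    consecutive points lie in [[0, 1[], so they leave a difference of absolute
    value less than [1]. *)
Lemma piece_length_approx (N : nat) (t : nat -> int) x :
  t 0%N = 0 -> t m.+1 = N%:Z ->
  (forall j, (j < m)%N ->
     (t j.+1)%:~R <= N%:R * order_stat x j < (t j.+1)%:~R + 1) ->
  forall j, (j <= m)%N ->
    `|N%:R * piece_length x j - (t j.+1 - t j)%:~R| < 1.
Proof.
move=> t0 tm tE j jm; rewrite piece_lengthE// mulrBr.
have up : (t j.+1)%:~R <= N%:R * (if (j < m)%N then order_stat x j else 1)
       < (t j.+1)%:~R + 1.
  case: ifP => [|/negbT]; first exact: tE.
  rewrite -leqNgt => mj; have -> : j = m by apply/eqP; rewrite eqn_leq jm.
  by rewrite tm mulr1 lexx /= ltrDl.
have dn : (t j)%:~R <= N%:R * (if j is j'.+1 then order_stat x j' else 0)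
       < (t j)%:~R + 1.
  case: j jm {up} => [|j] jm; last exact: tE.
  by rewrite t0 mulr0 lexx /= add0r.
rewrite intrB ltr_norml; move: up dn; set u := _ * _; set v := _ * _.
by move=> /andP[? ?] /andP[? ?]; apply/andP; split; lra.
Qed.

End OrderStatistics.

Lemma sum_Posz n (F : 'I_n -> nat) :
  (\sum_i F i)%N%:Z = \sum_i (F i)%:Z.
Proof. by rewrite -natz natr_sum; apply: eq_bigr => i _; rewrite natz. Qed.

Definition partial_sum n (g : 'I_n -> int) (j : nat) : int :=
  \sum_(l < n | (l < j)%N) g l.

Lemma partial_sum0 n (g : 'I_n -> int) : partial_sum g 0 = 0.
Proof. by rewrite /partial_sum big_pred0. Qed.

Lemma partial_sum_full n (g : 'I_n -> int) : partial_sum g n = \sum_(l < n) g l.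
Proof. by apply: eq_bigl => l; rewrite ltn_ord. Qed.

Lemma partial_sumS n (g : 'I_n -> int) (j : 'I_n) :
  partial_sum g j.+1 = partial_sum g j + g j.
Proof.
rewrite /partial_sum (bigD1 j)//= addrC; congr (_ + _); apply: eq_bigl => l.
by rewrite ltnS [RHS]ltn_neqAle andbC.
Qed.

Lemma partial_sum_telescope n (t : nat -> int) j : t 0%N = 0 -> (j <= n)%N ->
  partial_sum (fun l : 'I_n => t l.+1 - t l) j = t j.
Proof.
move=> t0; elim: j => [|j IH] jn; first by rewrite partial_sum0 t0.
by rewrite (partial_sumS _ (Ordinal jn)) IH 1?ltnW//= addrC subrK.
Qed.

Lemma partial_sum_lt n (g : 'I_n -> int) i j : (forall l, 0 < g l) ->
  (i < j <= n)%N -> partial_sum g i < partial_sum g j.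
Proof.
move=> g0 /andP[ij jn]; have il := leq_trans ij jn.
apply: (@lt_le_trans _ _ (partial_sum g i.+1)).
  by rewrite (partial_sumS _ (Ordinal il)) ltrDl.
rewrite /partial_sum big_mkcond [leRHS]big_mkcond; apply: ler_sum => l _.
case: ifPn => li; first by rewrite (leq_trans li).
by case: ifP => // _; exact/ltW.
Qed.

(** An injective family determines the permutation that sorts it: [p i] is the
    number of values smaller than the [i]-th one. *)
Lemma increasing_perm_unique n (f f' : 'I_n -> int) (p p' : 'S_n) :
  (forall i j : 'I_n, (i < j)%N -> f i < f j) ->
  (forall i j : 'I_n, (i < j)%N -> f' i < f' j) ->
  (forall i, f (p i) = f' (p' i)) -> p = p' /\ f =1 f'.
Proof.
move=> fmono f'mono ff'.
have rank (h : 'I_n -> int) (s : 'S_n) :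
    (forall i j : 'I_n, (i < j)%N -> h i < h j) ->
    forall i, #|[set j | h (s j) < h (s i)]| = s i.
  move=> hmono i.
  have hlt a b : (h a < h b) = (a < b)%N.
    case: (ltngtP a b) => [/hmono//|/hmono/ltW|/val_inj->]; last exact: ltxx.
    by rewrite leNgt => /negbTE.
  rewrite -[RHS]subn0 -(card_ord_window 0 (ltnW (ltn_ord (s i)))).
  rewrite -(card_imset _ (@perm_inj _ s)); congr #|pred_of_set _|.
  apply/setP => b; apply/imsetP/idP => [[j + ->]|]; rewrite !inE ?hlt//.
  by move=> bi; exists ((s^-1)%g b); rewrite ?inE permKV ?hlt.
have pp' : p = p'.
  apply/permP => i; apply: val_inj => /=.
  rewrite -(rank f p fmono) -(rank f' p' f'mono).
  by congr #|pred_of_set _|; apply/setP => j; rewrite !inE !ff'.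
by split=> // i; have := ff' ((p^-1)%g i); rewrite -pp' permKV.
Qed.

(** * Grid cells and configurations without polygon *)

(** Ranks are numbered from [0].  For [r >= k - 1] the window of [r] consists of
    the [k - 1] preceding ranks, and a nonnegative input at [r] says that no
    [k]-gon has its longest side of rank [r]; for smaller [r] the window is the
    single preceding rank, and a nonnegative input says that the lengths are
    sorted. *)
Definition window_start (k r : nat) : nat :=
  if (r < k.-1)%N then r.-1 else (r - k.-1)%N.

Lemma window_start_lt k r : (2 <= k)%N -> (window_start k r.+1 <= r)%N.
Proof. by rewrite /window_start; case: ifP => //=; lia. Qed.

Lemma window_size k r : (2 <= k)%N -> (r - window_start k r <= k.-1)%N.
Proof. by rewrite /window_start; case: ifP => //=; lia. Qed.

(** The [l]-th piece has rank [q l] among the lengths. *)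
Definition grid_gap m k (q : 'S_m.+1) (a : nat -> int) (l : 'I_m.+1) : int :=
  window_seq (window_start k) a (q l).

(** The [i]-th breaking point has rank [p i] on the stick, so it ends the piece
    number [p i], and its position is the total length of the pieces up to it. *)
Definition grid_point m k (p : 'S_m) (q : 'S_m.+1) (a : nat -> int)
    (i : 'I_m) : int :=
  partial_sum (grid_gap k q a) (p i).+1.

Lemma sum_grid_gap m k (q : 'S_m.+1) (a : nat -> int) :
  partial_sum (grid_gap k q a) m.+1 =
  \sum_(i < m.+1) (window_weight (window_start k) m.+1 i)%:Z * a i.
Proof.
rewrite partial_sum_full -sum_window_seq.
by rewrite [RHS](reindex_inj (@perm_inj _ q)).
Qed.

Section Positive.
Variables (m k : nat) (c : int).
Hypotheses (k2 : (2 <= k)%N) (c0 : 0 < c).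

(** The inputs are at least [c], and every window contains the preceding
    rank. *)
Lemma window_seq_homo a : (forall i, c <= a i) ->
  forall i j, (i < j)%N ->
    window_seq (window_start k) a i + c <= window_seq (window_start k) a j.
Proof.
move=> ac i; elim=> // j IH; rewrite ltnS leq_eqVlt => /orP[/eqP->|ij].
  exact/window_seq_lt/window_start_lt.
rewrite (le_trans (IH ij))//.
rewrite (le_trans _ (window_seq_lt c0 ac (window_start_lt j k2)))//.
by rewrite lerDl ltW.
Qed.

Lemma grid_gap_gt0 (q : 'S_m.+1) a : (forall i, c <= a i) ->
  forall l, 0 < grid_gap k q a l.
Proof.
move=> ac l; rewrite (lt_le_trans c0)// (le_trans (ac (q l)))//.
rewrite /grid_gap window_seqE lerDl big_nat sumr_ge0// => j _.
by apply: window_seq_ge0 => i; rewrite (le_trans (ltW c0)).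
Qed.

(** With positive inputs neither the breaking points nor the lengths have ties,
    so each of the two orders can be read off from the cell; the inputs are then
    the differences in the recurrence.  The total length has to agree because
    the last piece ends at no breaking point. *)
Lemma grid_point_inj (p p' : 'S_m) (q q' : 'S_m.+1) (a a' : nat -> int) :
  (forall i, c <= a i) -> (forall i, c <= a' i) ->
  partial_sum (grid_gap k q a) m.+1 = partial_sum (grid_gap k q' a') m.+1 ->
  (forall i, grid_point k p q a i = grid_point k p' q' a' i) ->
  [/\ p = p', q = q' & forall r, (r < m.+1)%N -> a r = a' r].
Proof.
move=> ac a'c sumE ptE.
have tmono b (s : 'S_m.+1) : (forall i, c <= b i) ->
    forall i j : 'I_m, (i < j)%N ->
    partial_sum (grid_gap k s b) i.+1 < partial_sum (grid_gap k s b) j.+1.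
  move=> bc i j ij; apply: partial_sum_lt; first exact: grid_gap_gt0.
  by rewrite ltnS ij /= ltnS ltnW.
have [pp' tE] := increasing_perm_unique (tmono _ q ac) (tmono _ q' a'c) ptE.
have gapE l : grid_gap k q a l = grid_gap k q' a' l.
  have tE' j : (j <= m.+1)%N ->
      partial_sum (grid_gap k q a) j = partial_sum (grid_gap k q' a') j.
    case: j => [|j] jm; first by rewrite !partial_sum0.
    move: jm; rewrite ltnS leq_eqVlt => /orP[/eqP->//|jm].
    exact: tE (Ordinal jm).
  have := tE' l.+1 (ltn_ord l); rewrite !partial_sumS tE' 1?ltnW//.
  exact: addrI.
have wmono b : (forall i, c <= b i) -> forall i j : 'I_m.+1, (i < j)%N ->
    window_seq (window_start k) b i < window_seq (window_start k) b j.
  move=> bc i j ij; rewrite (lt_le_trans _ (window_seq_homo bc ij))//.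
  by rewrite ltrDl.
have [qq' wE] := increasing_perm_unique (wmono _ ac) (wmono _ a'c) gapE.
split=> // r rm; have := wE (Ordinal rm); rewrite /= !window_seqE.
rewrite (_ : \sum_(_ <= _ < _) window_seq _ a _ =
             \sum_(window_start k r <= i < r) window_seq (window_start k) a' i).
  exact: addIr.
apply: eq_big_nat => i /andP[_ ir].
exact: (wE (Ordinal (ltn_trans ir rm))).
Qed.

End Positive.

Section Cells.
Variables (R : realType) (m k N : nat).
Hypotheses (k2 : (2 <= k)%N) (N0 : (0 < N)%N).
Let beta i := window_weight (window_start k) m.+1 i.

Definition in_cell (y : 'I_m -> int) (x : 'I_m -> R) : Prop :=
  forall i, (y i)%:~R <= N%:R * x i < (y i)%:~R + 1.

Definition no_polygon (x : 'I_m -> R) : Prop :=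
  forall A : {set 'I_m.+1}, #|A| = k ->
    ~ forms_polygon (fun j : 'I_m.+1 => piece_length x j) A.

(** Rounding costs less than one unit for the longest piece and for each of the
    [k - 1] others, so a slack of at least [k] units on the grid survives. *)
Lemma no_polygon_in_cell (p : 'S_m) (q : 'S_m.+1) (a : nat -> int) x :
  (forall i, k%:Z <= a i) ->
  \sum_(i < m.+1) (beta i)%:Z * a i = N%:Z ->
  in_cell (grid_point k p q a) x -> no_polygon x.
Proof.
move=> ak sumN cell.
have k0 : 0 < k%:Z :> int by rewrite ltz_nat (leq_trans _ k2).
set g := grid_gap k q a; set t := partial_sum g.
have g0 := grid_gap_gt0 k k0 q ak.
pose s (j : 'I_m) := x ((p^-1)%g j).
have tE (j : 'I_m) : (t j.+1)%:~R <= N%:R * s j < (t j.+1)%:~R + 1.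
  by have := cell ((p^-1)%g j); rewrite /grid_point permKV.
have N0R : 0 < N%:R :> R by rewrite ltr0n.
have smono (i j : 'I_m) : (i < j)%N -> s i < s j.
  move=> ij; rewrite -(ltr_pM2l N0R).
  have : t i.+1 + 1 <= t j.+1.
    by rewrite lezD1; apply: partial_sum_lt => //; rewrite ltnS ij /= ltnS ltnW.
  rewrite -(ler_int R) intrD; have /andP[_ hi] := tE i; have /andP[hj _] := tE j.
  by move=> hij; rewrite (lt_le_trans hi)// (le_trans hij).
have osE (j : 'I_m) : order_stat x j = s j.
  by apply: (order_stat_unique (p := p) smono) => i; rewrite /s permK.
have pieceE (j : 'I_m.+1) : `|N%:R * piece_length x j - (g j)%:~R| < 1.
  have := @piece_length_approx R m N t x; rewrite /t partial_sum0.
  rewrite sum_grid_gap => /(_ erefl sumN) => /(_ _ j (leq_ord j)).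
  rewrite partial_sumS [X in X%:~R]addrC addKr; apply=> j' jm'.
  by have := tE (Ordinal jm'); rewrite -osE.
pose zb r := piece_length x ((q^-1)%g (inord r)).
have zE (j : 'I_m.+1) : piece_length x j = zb (q j).
  by rewrite /zb inord_val permK.
pose w := window_seq (window_start k) a.
have zbE r : (r < m.+1)%N -> (w r)%:~R - 1 < N%:R * zb r < (w r)%:~R + 1.
  move=> rm; have := pieceE ((q^-1)%g (inord r)).
  rewrite /g /grid_gap permKV inordK// -/(zb r) -/(w r).
  by rewrite ltr_norml => /andP[? ?]; apply/andP; split; lra.
have kR : 2 <= k%:R :> R by rewrite ler_nat.
apply: (no_polygon_of_window_le zE).
  move=> i j /andP[ij jm]; rewrite -(ltr_pM2l N0R).
  have := window_seq_homo k2 k0 ak ij; rewrite -(ler_int R) intrD -/(w i) -/(w j).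
  have /andP[_ hi] := zbE i (ltn_trans ij jm); have /andP[hj _] := zbE j jm.
  rewrite -[k%:Z%:~R]/(k%:R) => hij; lra.
move=> r /andP[kr rm]; rewrite -(ler_pM2l N0R) mulr_sumr ltW//.
have /andP[+ _] := zbE r rm; apply: le_lt_trans.
have -> : w r = a r + \sum_(r - k.-1 <= i < r) w i.
  by rewrite /w window_seqE {1}/window_start ltnNge kr.
apply: (@le_trans _ _ (\sum_(r - k.-1 <= i < r) ((w i)%:~R + 1))).
  rewrite !big_nat; apply: ler_sum => i /andP[_ ir].
  by have /andP[_ /ltW] := zbE i (ltn_trans ir rm).
rewrite big_split /= sumr_const_nat subKn// intrD raddf_sum /=.
have : k%:R <= (a r)%:~R :> R by have := ak r; rewrite -(ler_int R).
rewrite -{1}(prednK (ltnW k2)) -natr1; set u := \sum_(_ <= _ < _) _; lra.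
Qed.

(** Take for [p] and [q] the actual orders of the points and of the lengths, and
    for [a] the slacks of the rounded lengths.  The true slacks are nonnegative
    and rounding changes them by less than [k], so [a + k] is a vector of
    natural numbers. *)
Lemma grid_cover x : (forall i, 0 <= x i <= 1) -> no_polygon x ->
  exists p : 'S_m, exists q : 'S_m.+1, exists h : seq nat,
    [/\ size h = m.+1,
        (\sum_(i < m.+1) beta i * nth 0 h i = N + k * \sum_(i < m.+1) beta i)%N &
        in_cell (grid_point k p q (fun i => (nth 0%N h i)%:Z - k%:Z)) x].
Proof.
move=> x01 nopoly; have N0R : 0 < N%:R :> R by rewrite ltr0n.
have [p xE] := order_stat_perm x.
pose t j : int := if j is j'.+1 then
    if (j' < m)%N then Num.floor (N%:R * order_stat x j') else N%:Z
  else 0.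
have tE j : (j < m)%N ->
    (t j.+1)%:~R <= N%:R * order_stat x j < (t j.+1)%:~R + 1.
  move=> jm; rewrite /t jm.
  by have := floor_itv (N%:R * order_stat x j); rewrite intrD.
have tm : t m.+1 = N%:Z by rewrite /t ltnn.
pose g (l : 'I_m.+1) := t l.+1 - t l.
have pieceE (j : 'I_m.+1) : `|N%:R * piece_length x j - (g j)%:~R| < 1.
  exact: (piece_length_approx (erefl : t 0%N = 0) tm tE (leq_ord j)).
pose z (j : 'I_m.+1) := piece_length x j.
have [q zE] := order_stat_perm z.
have zmono i j : (i <= j < m.+1)%N -> order_stat z i <= order_stat z j.
  exact: order_stat_homo.
have winle := window_le_of_no_polygon (ltnW k2) zE zmono nopoly.
pose w r := g ((q^-1)%g (inord r)).
have wE r : (r < m.+1)%N -> (w r)%:~R - 1 < N%:R * order_stat z r < (w r)%:~R + 1.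
  move=> rm; have := pieceE ((q^-1)%g (inord r)).
  rewrite -/(z _) zE permKV inordK// -/(w r).
  by rewrite ltr_norml => /andP[? ?]; apply/andP; split; lra.
have winle' r : (r < m.+1)%N ->
    \sum_(window_start k r <= i < r) order_stat z i <= order_stat z r.
  move=> rm; rewrite /window_start; case: ifPn => [rk|]; last first.
    by rewrite -leqNgt => kr; apply: winle; rewrite kr.
  case: r {rk} rm => [|r] rm /=; last by rewrite big_nat1 zmono// leqnSn.
  rewrite big_geq//; have := zE ((q^-1)%g (inord 0)); rewrite permKV inordK// => <-.
  exact: piece_length_ge0 (leq_ord _) x01.
pose d r := w r - \sum_(window_start k r <= i < r) w i.
have dk r : (r < m.+1)%N -> 0 <= d r + k%:Z.
  move=> rm; have := winle' r rm; rewrite -(ler_pM2l N0R) mulr_sumr => le_r.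
  have /andP[_ hi] := wE r rm.
  have lo : \sum_(window_start k r <= i < r) ((w i)%:~R - 1) <=
      \sum_(window_start k r <= i < r) N%:R * order_stat z i :> R.
    rewrite !big_nat; apply: ler_sum => i /andP[_ ir].
    by have /andP[/ltW] := wE i (ltn_trans ir rm).
  move: lo; rewrite sumrB sumr_const_nat -(raddf_sum (intmul 1))/= => lo.
  have : (r - window_start k r)%:R <= k.-1%:R :> R by rewrite ler_nat window_size.
  have : k%:R = k.-1%:R + 1 :> R by rewrite natr1 prednK// ltnW.
  move=> kE szle.
  have dE : (d r)%:~R =
      (w r)%:~R - (\sum_(window_start k r <= i < r) w i)%:~R :> R.
    by rewrite intrB.
  rewrite -ltzD1 -(ltr_int R) intrD intrD dE -[k%:Z%:~R]/(k%:R) mulr0z mulr1z.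
  lra.
pose h := mkseq (fun r => absz (d r + k%:Z)) m.+1.
have hE r : (r < m.+1)%N -> (nth 0%N h r)%:Z - k%:Z = d r.
  by move=> rm; rewrite nth_mkseq// gez0_abs ?dk// addrK.
have wseq r : (r < m.+1)%N ->
    w r = window_seq (window_start k) (fun i => (nth 0%N h i)%:Z - k%:Z) r.
  by apply: window_seq_uniq => i im; rewrite hE// /d subrK.
have gE l : grid_gap k q (fun i => (nth 0%N h i)%:Z - k%:Z) l = g l.
  by rewrite /grid_gap -wseq// /w inord_val permK.
have psE j : (j <= m.+1)%N ->
    partial_sum (grid_gap k q (fun i => (nth 0%N h i)%:Z - k%:Z)) j = t j.
  move=> jm; rewrite -(partial_sum_telescope (n := m.+1) (erefl : t 0%N = 0) jm).
  by apply: eq_bigr => l _; rewrite gE.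
exists p, q, h; split; first by rewrite size_mkseq.
  have := psE m.+1 (leqnn _); rewrite sum_grid_gap tm.
  under eq_bigr do rewrite mulrBr.
  rewrite sumrB -mulr_suml => /eqP; rewrite subr_eq => /eqP e.
  apply/eqP; rewrite -eqz_nat PoszD PoszM !sum_Posz mulrC -e; apply/eqP.
  by apply: eq_bigr => i _; rewrite PoszM.
by move=> i; rewrite /grid_point psE ?ltnS ?(ltnW (ltn_ord _))// xE; exact: tE.
Qed.

End Cells.

(** * Measurability and finite unions *)
Local Open Scope classical_set_scope.

Section FiniteMeasurability.
Variables (d : measure_display) (T : measurableType d).

Lemma measurable_forall (I : finType) (A : I -> set T) :
  (forall i, measurable (A i)) -> measurable [set w | forall i, A i w].
Proof.
move=> mA; rewrite (_ : mkset _ = \bigcap_(i in setT) A i).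
  by apply: fin_bigcap_measurable => //; exact: finite_finset.
by apply/seteqP; split=> w /= Aw i; [move=> _|]; exact: Aw.
Qed.

Lemma measurable_exists (I : finType) (A : I -> set T) :
  (forall i, measurable (A i)) -> measurable [set w | exists i, A i w].
Proof.
move=> mA; rewrite (_ : mkset _ = \bigcup_(i in setT) A i).
  by apply: fin_bigcup_measurable => //; exact: finite_finset.
by apply/seteqP; split=> w /= [i]; [exists i|move=> _; exists i].
Qed.

Lemma measurable_imply (Q : Prop) (A : set T) :
  measurable A -> measurable [set w | Q -> A w].
Proof.
move=> mA; have [q|nq] := pselect Q.
  by rewrite (_ : mkset _ = A)//; apply/seteqP; split=> w /=; [exact|move=> Aw _].
by rewrite (_ : mkset _ = setT)//; apply/seteqP; split=> w //= _ /nq.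
Qed.

Variable R : realType.

(** The [j]-th order statistic is at least [r] iff at most [j] of the values are
    smaller than [r], and counting values below [r] is measurable. *)
Lemma measurable_order_stat m (X : 'I_m -> T -> R) j :
  (forall i, measurable_fun setT (X i)) ->
  measurable_fun setT (fun w => order_stat (X ^~ w) j).
Proof.
move=> mX; have [jm|mj] := ltnP j m; last first.
  rewrite (_ : (fun w => _) = cst 0); first exact: measurable_cst.
  by apply/funext => w; rewrite /order_stat nth_default// size_sort_values.
apply: (measurability (@RGenCInfty.G R)) => [|/= _ [_] [r] -> <-].
  exact: RGenCInfty.measurableE.
rewrite setTI (_ : _ @^-1` _ =
    setT `&` [set w | \sum_(i < m) (if X i w < r then 1 else 0) <= j%:R :> R]).
  apply: measurable_fun_le => //; apply: measurable_sum => i.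
  by apply: measurable_fun_ifT => //; exact: measurable_fun_ltr.
have cE w : \sum_(i < m) (if X i w < r then 1 else 0) =
    (count (< r) [seq X i w | i <- enum 'I_m])%:R :> R.
  by rewrite -sum1_count big_map big_enum_cond/= natr_sum [RHS]big_mkcond.
rewrite setTI; apply/seteqP; split => w /=; rewrite in_itv/= andbT cE ler_nat.
- move=> rj; rewrite leqNgt; apply/negP => jc.
  move: rj; rewrite leNgt => /negP; apply.
  apply: nth_count_lt; last by rewrite count_sort.
  by apply: sort_sorted; exact: le_total.
- move=> cj; rewrite leNgt; apply/negP => jr.
  move: cj; rewrite leqNgt => /negP; apply.
  rewrite -(count_sort <=%O) ltnNge; apply/negP => cj.
  move: jr; rewrite ltNge => /negP; apply.
  apply: Order.TotalTheory.DualTotalTheory.nth_count_ge.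
    by apply: sort_sorted; exact: le_total.
  by rewrite cj size_sort_values.
Qed.

Lemma measurable_piece_length m (X : 'I_m -> T -> R) j : (j <= m)%N ->
  (forall i, measurable_fun setT (X i)) ->
  measurable_fun setT (fun w => piece_length (X ^~ w) j).
Proof.
move=> jm mX; under eq_fun do rewrite piece_lengthE//.
apply: measurable_funB.
  by case: ltnP => _; [exact: measurable_order_stat|exact: measurable_cst].
by case: j {jm} => [|j]; [exact: measurable_cst|exact: measurable_order_stat].
Qed.

Lemma measurable_no_polygon m k (X : 'I_m -> T -> R) :
  (forall i, measurable_fun setT (X i)) ->
  measurable [set w | no_polygon k (X ^~ w)].
Proof.
move=> mX.
have mle (f g : T -> R) : measurable_fun setT f -> measurable_fun setT g ->
    measurable [set w | f w <= g w].
  by move=> mf mg; have := measurable_fun_le measurableT mf mg; rewrite setTI.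
have mp (j : 'I_m.+1) := measurable_piece_length (leq_ord j) mX.
apply: measurable_forall => A; apply: measurable_imply.
apply: measurableC; apply: measurable_exists => j.
rewrite [X in measurable X](_ : _ =
    ([set w | ~ (j \in A -> False)] `&`
     [set w | forall i, i \in A ->
                piece_length (X ^~ w) i <= piece_length (X ^~ w) j])
    `&` ~` [set w | \sum_(i in A | i != j) piece_length (X ^~ w) i
                    <= piece_length (X ^~ w) j]).
  apply: measurableI; first apply: measurableI.
  - by apply: measurableC; apply: (@measurable_imply _ set0).
  - by apply: measurable_forall => i; apply: measurable_imply; exact: mle.
  - apply: measurableC; apply: mle => //.
    under eq_fun do rewrite big_mkcond/=.
    apply: measurable_sum => i.
    by case: (boolP ((i \in A) && (i != j))) => _.
apply/seteqP; split=> w /=.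
  by case=> jA jmax /lt_geF lt_j; rewrite lt_j; split=> //; split=> //; exact.
case=> -[jA jmax] /negP; rewrite -ltNge => lt_j; split=> //.
by apply: contrapT => /jA.
Qed.

End FiniteMeasurability.

Section Measures.
Variables (d : measure_display) (T : measurableType d) (R : realType).
Variable P : probability T R.

Lemma union_bound (I : choiceType) (L : seq I) (A : I -> set T) (E : set T)
    (c : R) :
  measurable E -> (forall i, measurable (A i)) ->
  (forall i, (P (A i) <= c%:E)%E) ->
  (forall w, E w -> exists2 i, i \in L & A i w) ->
  (P E <= ((size L)%:R * c)%:E)%E.
Proof.
move=> mE mA PA cover.
pose U s := \big[setU/set0]_(i <- s) A i.
have mU s : measurable (U s) by exact: bigsetU_measurable.
have EU : E `<=` U L.
  by move=> w /cover[i iL Aiw]; rewrite /U -bigcup_seq; exists i.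
apply: (@le_trans _ _ (P (U L))); first by apply: le_measure; rewrite ?inE.
elim: (L) => [|i s IH]; first by rewrite /U big_nil measure0 mul0r.
rewrite /U big_cons -/(U s) (le_trans (measureU2 P (mA i) (mU s)))//.
by rewrite -natr1 addrC mulrDl mul1r EFinD leeD//; exact: PA.
Qed.

Lemma disjoint_union_bound (I : choiceType) (L : seq I) (A : I -> set T)
    (E : set T) (c : R) :
  measurable E -> (forall i, measurable (A i)) -> uniq L ->
  (forall i, i \in L -> P (A i) = c%:E) ->
  (forall i, i \in L -> A i `<=` E) ->
  (forall i j w, i \in L -> j \in L -> A i w -> A j w -> i = j) ->
  (((size L)%:R * c)%:E <= P E)%E.
Proof.
move=> mE mA uL PA AE disj.
pose U s := \big[setU/set0]_(i <- s) A i.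
have mU s : measurable (U s) by exact: bigsetU_measurable.
have UE : U L `<=` E by move=> w; rewrite /U -bigcup_seq => -[i /AE]; exact.
apply: (@le_trans _ _ (P (U L))); last by apply: le_measure; rewrite ?inE.
suff -> : P (U L) = ((size L)%:R * c)%:E by [].
elim: L uL PA disj {AE UE} => [|i s IH] /=.
  by rewrite /U big_nil measure0 mul0r.
move=> /andP[iNs us] PA disj.
have AU0 : A i `&` U s = set0.
  rewrite -subset0 => w [Aiw]; rewrite /U -bigcup_seq => -[j /= js Ajw].
  have ij : i = j by apply: (disj i j w) => //; rewrite inE ?eqxx ?js ?orbT.
  by move: iNs; rewrite ij js.
have -> : P (U (i :: s)) = (P (A i) + P (U s))%E.
  by rewrite {1}/U big_cons; exact: (measureU P (mA i) (mU s) AU0).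
rewrite PA ?mem_head// IH//.
- by rewrite -EFinD -natr1 addrC mulrDl mul1r.
- by move=> j js; apply: PA; rewrite inE js orbT.
- by move=> j j' w js j's; apply: disj; rewrite inE ?js ?j's orbT.
Qed.

(** The density is the indicator function of the unit interval. *)
Lemma uniform01E (X : {RV P >-> R}) (A : set R) : uniform01 X -> measurable A ->
  P (X @^-1` A) = lebesgue_measure (A `&` `[0, 1]).
Proof.
move=> uX mA; have := uX A mA; rewrite /distribution/= /pushforward => ->.
rewrite /uniform_prob integral_uniform_pdf.
rewrite (eq_integral (fun=> 1%:E)); last first.
  by move=> x; rewrite inE/= in_itv/= /uniform_pdf => -[_ ->]; rewrite subr0 invr1.
by rewrite integral_cst ?mul1e//; exact: measurableI.
Qed.

End Measures.

(** * Probability of the grid cells *)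

Section Squeeze.
Variable R : realType.

Lemma bernoulli_sub (x : R) n : 0 <= x <= 1 -> 1 - n%:R * x <= (1 - x) ^+ n.
Proof.
move=> /andP[x0 x1]; elim: n => [|n IH]; first by rewrite mul0r subr0 expr0.
rewrite exprS (le_trans _ (ler_wpM2l _ IH)) ?subr_ge0//.
have : 0 <= n%:R * x * x by rewrite !mulr_ge0.
by rewrite -natr1; nra.
Qed.

Lemma small_ratio (K e : R) (N0 : nat) : 0 <= K -> 0 < e ->
  exists N : nat, [/\ (0 < N)%N, (N0 <= N)%N & K / N%:R <= e].
Proof.
move=> K0 e0; exists (Num.bound (K / e) + N0).+1; split=> //.
  by rewrite (leq_trans (leq_addl _ _) (leqnSn _)).
rewrite ler_pdivrMr ?ltr0n// -ler_pdivrMl// mulrC.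
rewrite (le_trans (ltW (archi_boundP _))) ?divr_ge0 ?(ltW e0)//.
by rewrite ler_nat (leq_trans (leq_addr _ _) (leqnSn _)).
Qed.

(** Both bounds tend to [1].  The upper one is handled through
    [(1 + x)^m (1 - x)^m <= 1], so that the Bernoulli inequality for [1 - x]
    serves for both. *)
Lemma ratio_squeeze (r : R) (m C D : nat) :
  (forall N, (0 < N)%N -> (C <= N)%N ->
     ((N - C)%N%:R / N%:R) ^+ m <= r <= ((N + D)%N%:R / N%:R) ^+ m) -> r = 1.
Proof.
move=> bounds; apply/eqP; rewrite eq_le; apply/andP; split.
  have r0 : 0 <= r.
    have /andP[+ _] := bounds C.+1 isT (leqnSn C); apply: le_trans.
    by rewrite exprn_ge0// divr_ge0.
  apply/ler_addgt0Pr => e e0.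
  have rmD0 := mulr_ge0 (mulr_ge0 r0 (ler0n R m)) (ler0n R D).
  have [N [N0 NCD Ne]] := small_ratio (C + D) rmD0 e0.
  have NR : 0 < N%:R :> R by rewrite ltr0n.
  have CN : (C <= N)%N := leq_trans (leq_addr _ _) NCD.
  have DN : (D <= N)%N := leq_trans (leq_addl _ _) NCD.
  set x : R := D%:R / N%:R.
  have x01 : 0 <= x <= 1 by rewrite divr_ge0//= ler_pdivrMr// mul1r ler_nat.
  have /andP[_ hr] := bounds N N0 CN.
  have {}hr : r <= (1 + x) ^+ m by rewrite (le_trans hr)// natrD mulrDl divff ?gt_eqF.
  have h1 : r * (1 - x) ^+ m <= 1.
    have : r * (1 - x) ^+ m <= (1 + x) ^+ m * (1 - x) ^+ m.
      by rewrite ler_wpM2r// exprn_ge0// subr_ge0; case/andP: x01.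
    move=> /le_trans; apply; rewrite -exprMn; apply: exprn_ile1; case/andP: x01; nra.
  have := ler_wpM2l r0 (bernoulli_sub m x01).
  have : r * (m%:R * x) <= e by move: Ne; rewrite /x !mulrA.
  rewrite mulrBr mulr1; lra.
apply/ler_addgt0Pr => e e0.
have [N [N0 CN Ne]] := small_ratio C (mulr_ge0 (ler0n R m) (ler0n R C)) e0.
have NR : 0 < N%:R :> R by rewrite ltr0n.
have /andP[hr _] := bounds N N0 CN.
set x : R := C%:R / N%:R.
have x01 : 0 <= x <= 1 by rewrite divr_ge0//= ler_pdivrMr// mul1r ler_nat.
have := bernoulli_sub m x01; have : (1 - x) ^+ m <= r.
  by move: hr; rewrite natrB// mulrBl divff ?gt_eqF.
have : m%:R * x <= e by rewrite mulrA.
lra.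
Qed.
End Squeeze.

Section Cells.
Variables (d : measure_display) (T : measurableType d) (R : realType).
Variables (P : probability T R) (m : nat) (X : 'I_m -> {RV P >-> R}).
Hypotheses (Xindep : mutually_independent X) (Xunif : forall i, uniform01 (X i)).

Lemma prob_box (A : 'I_m -> set R) : (forall i, measurable (A i)) ->
  P [set w | forall i, A i (X i w)] =
  (\prod_i fine (lebesgue_measure (A i `&` `[0, 1])))%:E.
Proof.
move=> mA; have := @Xindep finset.setT A mA.
rewrite (_ : [set w | forall i, i \in finset.setT -> A i (X i w)] =
             [set w | forall i, A i (X i w)]); last first.
  apply/seteqP; split=> w /= Aw i; last by move=> _; exact: Aw.
  exact: (Aw i (finset.in_setT i)).
move=> ->; rewrite -prodEFin; apply: eq_big => [i|i _]; first by rewrite finset.in_setT.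
rewrite uniform01E// fineK//.
rewrite ge0_fin_numE// (@le_lt_trans _ _ (lebesgue_measure (`[0, 1] : set R)))//.
  apply: le_measure; rewrite ?inE//; by apply: measurableI => //; exact: mA.
by rewrite lebesgue_measure_itv/= lte_fin ltr01 -EFinD ltry.
Qed.

Definition cell N (y : 'I_m -> int) := [set w | in_cell N y (X ^~ w)].

Section Grid.
Variable N : nat.
Hypothesis N0 : (0 < N)%N.

Let cell_itv (y : int) : set R := `[y%:~R / N%:R, (y%:~R + 1) / N%:R[.

Let cellE y : cell N y = [set w | forall i, cell_itv (y i) (X i w)].
Proof.
have NR : 0 < N%:R :> R by rewrite ltr0n.
apply/seteqP; split=> w /= yw i; have := yw i;
  by rewrite /cell_itv /= in_itv/= ler_pdivrMr// ltr_pdivlMr// ![_ * N%:R]mulrC.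
Qed.

Let cell_itv_length (y : int) : lebesgue_measure (cell_itv y) = (N%:R^-1)%:E.
Proof.
have NR : 0 < N%:R :> R by rewrite ltr0n.
rewrite lebesgue_measure_itv/= lte_fin ltr_pM2r ?invr_gt0// ltrDl ltr01.
by rewrite -EFinD -mulrBl addrAC subrr add0r mul1r.
Qed.

Lemma measurable_cell y : measurable (cell N y).
Proof.
rewrite cellE; apply: measurable_forall => i.
exact: (measurable_funPTI (X i) (measurable_itv _)).
Qed.

(** Only an upper bound: a cell that sticks out of the unit cube has smaller
    probability. *)
Lemma prob_cell_le y : (P (cell N y) <= (N%:R^-1 ^+ m)%:E)%E.
Proof.
rewrite cellE (prob_box (fun i => measurable_itv _)).
rewrite lee_fin -[in leRHS](card_ord m) -prodr_const; apply: ler_prod => i _.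
rewrite fine_ge0//= -[leRHS]/(fine (N%:R^-1)%:E) -(cell_itv_length (y i)).
apply: fine_le; rewrite ?cell_itv_length//; last first.
  rewrite -(cell_itv_length (y i)); apply: le_measure; rewrite ?inE//.
    by apply: measurableI => //; exact: measurable_itv.
  exact: measurable_itv.
rewrite ge0_fin_numE// (@le_lt_trans _ _ (lebesgue_measure (cell_itv (y i))))//.
  apply: le_measure; rewrite ?inE//.
    by apply: measurableI => //; exact: measurable_itv.
  exact: measurable_itv.
by rewrite cell_itv_length ltry.
Qed.

Lemma prob_cell y : (forall i, 0 <= y i < N%:Z) ->
  P (cell N y) = (N%:R^-1 ^+ m)%:E.
Proof.
move=> yN; have NR : 0 < N%:R :> R by rewrite ltr0n.
rewrite cellE (prob_box (fun i => measurable_itv _)).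
rewrite -[in RHS](card_ord m) -prodr_const; congr _%:E; apply: eq_bigr => i _.
rewrite setIidl ?cell_itv_length// => x; rewrite /cell_itv /= !in_itv/=.
have /andP[y0 yi] := yN i; move=> /andP[xl xr]; apply/andP; split.
  by rewrite (le_trans _ xl)// divr_ge0// ler0z.
rewrite (le_trans (ltW xr))// ler_pdivrMr// mul1r.
by move: yi; rewrite -lezD1 -(ler_int R) intrD.
Qed.

End Grid.

Lemma prob_unit_box : P [set w | forall i, 0 <= X i w <= 1] = 1%:E.
Proof.
have := @prob_box (fun=> `[0, 1]) (fun=> measurable_itv _).
rewrite setIid lebesgue_measure_itv/= lte_fin ltr01 -EFinD/= subr0 big1_eq => <-.
by congr (P _); apply/seteqP; split=> w /= wX i; have := wX i; rewrite in_itv.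
Qed.

End Cells.

Section Bounds.
Variables (d : measure_display) (T : measurableType d) (R : realType).
Variables (P : probability T R) (m k : nat) (X : 'I_m -> {RV P >-> R}).
Hypothesis k2 : (2 <= k)%N.
Hypotheses (Xindep : mutually_independent X) (Xunif : forall i, uniform01 (X i)).

Let beta i := window_weight (window_start k) m.+1 i.
Let bs := [seq beta i | i <- iota 0 m].
Let C := (k * \sum_(i < m.+1) beta i)%N.
Let E := [set w | no_polygon k (X ^~ w)].

Let mE : measurable E.
Proof. exact: measurable_no_polygon. Qed.

Let bsE : rcons bs 1%N = [seq beta i | i <- iota 0 m.+1].
Proof.
by rewrite -[m.+1]addn1 iotaD map_cat /= cats1 add0n /beta window_weight_last.
Qed.

Let bs_gt0 : all (leq 1) (rcons bs 1%N).
Proof.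
rewrite bsE; apply/allP => b /mapP[i +  ->]; rewrite mem_iota => /andP[_ im].
exact: window_weight_gt0.
Qed.

Let mem_sols M h : (h \in weighted_sols (rcons bs 1%N) M) =
  (size h == m.+1) && (\sum_(i < m.+1) beta i * nth 0 h i == M)%N.
Proof.
rewrite mem_weighted_sols// size_rcons size_map size_iota; congr (_ && (_ == _)).
apply: eq_bigr => i _; rewrite bsE (nth_map 0%N) ?size_iota// nth_iota//.
Qed.

Let perms := enum {: 'S_m * 'S_m.+1}.
(** Descriptions of cells: the two orders together with a solution [h] of the
    weighted equation of total [M]. *)
Let codes M := [seq (s, h) | s <- perms, h <- weighted_sols (rcons bs 1%N) M].

Let size_codes M : size (codes M) =
  (m`! * m.+1`! * size (weighted_sols (rcons bs 1%N) M))%N.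
Proof. by rewrite size_allpairs -cardE card_prod !card_Sn. Qed.

(** Union bound over the cells of [grid_cover]. *)
Lemma prob_no_polygon_le N : (0 < N)%N ->
  (P E <= ((size (codes (N + C)))%:R * N%:R^-1 ^+ m)%:E)%E.
Proof.
move=> N0; pose box := [set w | forall i, 0 <= X i w <= 1].
have mbox : measurable box.
  apply: measurable_forall => i.
  rewrite (_ : (fun w => _) = X i @^-1` `[0, 1]).
    exact: (measurable_funPTI (X i) (measurable_itv _)).
  by apply/seteqP; split=> w /=; rewrite in_itv.
(* the breaking points lie on the stick almost surely *)
have -> : P E = P (E `&` box).
  apply/eqP; rewrite eq_le; apply/andP; split; last first.
    by apply: le_measure; rewrite ?inE//; exact: measurableI.
  apply: (@le_trans _ _ (P ((E `&` box) `|` ~` box))).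
    apply: le_measure; rewrite ?inE//.
      by apply: measurableU; [exact: measurableI|exact: measurableC].
    by move=> w Ew; have [bw|nb] := pselect (box w); [left|right].
  apply: (le_trans (measureU2 P (measurableI _ _ mE mbox) (measurableC mbox))).
  rewrite [X in (_ + X <= _)%E](_ : _ = 0%E) ?adde0//.
  transitivity (1 - P box)%E; first exact: probability_setC.
  by rewrite (prob_unit_box Xindep Xunif) subee.
pose A (c : ('S_m * 'S_m.+1) * seq nat) := cell X N
  (grid_point k c.1.1 c.1.2 (fun i => (nth 0%N c.2 i)%:Z - k%:Z)).
apply: (@union_bound _ _ _ P _ _ A).
- exact: measurableI.
- by move=> c; exact: measurable_cell.
- by move=> c; exact: prob_cell_le.
- move=> w [Ew bw].
  have [p [q [h [sh sum_h cell_w]]]] := grid_cover k2 N0 bw Ew.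
  exists ((p, q), h) => //; apply/allpairsP; exists ((p, q), h); split=> //.
    by rewrite mem_enum.
  by rewrite mem_sols sh eqxx /= sum_h eqxx.
Qed.

(** The cells of [no_polygon_in_cell] are disjoint, since two cells sharing a
    point are equal and [grid_point_inj] recovers their description. *)
Lemma prob_no_polygon_ge N : (0 < N)%N -> (C <= N)%N ->
  (((size (codes (N - C)))%:R * N%:R^-1 ^+ m)%:E <= P E)%E.
Proof.
move=> N0 CN; have k0 : 0 < k%:Z :> int by rewrite ltz_nat (leq_trans _ k2).
pose a (h : seq nat) i : int := (nth 0%N h i)%:Z + k%:Z.
have ak h i : k%:Z <= a h i by rewrite lerDr.
have codeP c : c \in codes (N - C) ->
    size c.2 = m.+1 /\ \sum_(i < m.+1) (beta i)%:Z * a c.2 i = N%:Z.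
  case/allpairsP=> -[s h] /= [_ + ->] /=; rewrite mem_sols => /andP[/eqP-> /eqP sM].
  split=> //; rewrite /a; under eq_bigr do rewrite mulrDr -PoszM.
  by rewrite big_split/= -mulr_suml -!sum_Posz sM -PoszM -PoszD mulnC -/C subnK.
pose A (c : ('S_m * 'S_m.+1) * seq nat) := cell X N
  (grid_point k c.1.1 c.1.2 (a c.2)).
apply: (@disjoint_union_bound _ _ _ P _ _ A) => //.
- by move=> c; exact: measurable_cell.
- apply: allpairs_uniq; [exact: enum_uniq|exact: uniq_weighted_sols|].
  by move=> [? ?] [? ?].
- move=> c /codeP[_ sumN]; apply: prob_cell => // i.
  have g0 := grid_gap_gt0 k k0 c.1.2 (ak c.2).
  rewrite /grid_point -sumN -(sum_grid_gap k c.1.2); apply/andP; split.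
    rewrite -(partial_sum0 (grid_gap k c.1.2 (a c.2))) ltW// partial_sum_lt//=.
    by rewrite ltnS ltnW.
  by apply: partial_sum_lt => //; rewrite ltnS ltn_ord /=.
- by move=> c /codeP[_ sumN] w; apply: no_polygon_in_cell.
- move=> [[p q] h] [[p' q'] h'] w /codeP/= [sh sumN] /codeP/= [sh' sumN'] cw cw'.
  have yy' i : grid_point k p q (a h) i = grid_point k p' q' (a h') i.
    (* both are the integer part of the same real number *)
    have := cw i; have := cw' i; rewrite -!(intrD _ _ 1) /=.
    by move=> /floor_def <- /floor_def <-.
  have sumE : partial_sum (grid_gap k q (a h)) m.+1 =
      partial_sum (grid_gap k q' (a h')) m.+1 by rewrite !sum_grid_gap sumN sumN'.
  have [-> -> hh'] := grid_point_inj k2 k0 (ak h) (ak h') sumE yy'.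
  congr (_, _); apply: (@eq_from_nth _ 0%N); first by rewrite sh sh'.
  by move=> i; rewrite sh => im; have /addIr[] := hh' i im.
Qed.

Lemma prob_no_polygonE :
  P E = ((m.+1)`!%:R / \prod_(i < m.+1) (beta i)%:R)%:E.
Proof.
have fE : (P E) \is a fin_num by exact: fin_num_measure.
set e := fine (P E); have eE : P E = e%:E by rewrite fineK.
rewrite eE; congr _%:E.
set p := (\prod_(b <- bs) b)%N.
have -> : \prod_(i < m.+1) (beta i)%:R = p%:R :> R.
  rewrite big_ord_recr /= /beta window_weight_last mulr1 /p /bs big_map.
  rewrite natr_prod -(big_mkord xpredT (fun i => (beta i)%:R)).
  by rewrite /index_iota subn0.
have pR : p%:R != 0 :> R.
  rewrite pnatr_eq0 -lt0n /p big_seq prodn_cond_gt0// => b bbs.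
  by move/allP: bs_gt0; apply; rewrite mem_rcons inE bbs orbT.
have fR : (m.+1)`!%:R != 0 :> R by rewrite pnatr_eq0 -lt0n fact_gt0.
have size_bs : size bs = m by rewrite size_map size_iota.
have all_bs : all (leq 1) bs by move: bs_gt0; rewrite all_rcons.
suff /divr1_eq <- : e * p%:R / (m.+1)`!%:R = 1 by rewrite mulfK.
apply: (@ratio_squeeze _ _ m C (C + \sum_(b <- bs) b)%N) => N N0 CN.
have NR : 0 < N%:R :> R by rewrite ltr0n.
have sizeE M : (size (codes M))%:R * N%:R^-1 ^+ m * p%:R / (m.+1)`!%:R =
    (m`! * p * size (weighted_sols (rcons bs 1%N) M))%N%:R * N%:R^-1 ^+ m :> R.
  rewrite size_codes; move: ((m.+1)`!)%N fR => f fR.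
  by rewrite !natrM; field.
have c0 : 0 <= p%:R / (m.+1)`!%:R :> R by rewrite divr_ge0.
have X0 : 0 <= N%:R^-1 ^+ m :> R by rewrite exprn_ge0// invr_ge0.
apply/andP; split.
- have := prob_no_polygon_ge N0 CN; rewrite eE lee_fin => /(ler_wpM2r c0).
  rewrite !mulrA sizeE; apply: le_trans; rewrite exprMn ler_wpM2r// -natrX ler_nat.
  by have /andP[+ _] := weighted_sols_bounds (N - C) all_bs; rewrite size_bs.
- have := prob_no_polygon_le N0; rewrite eE lee_fin => /(ler_wpM2r c0).
  rewrite !mulrA sizeE => /le_trans; apply; rewrite exprMn ler_wpM2r// -natrX ler_nat.
  by have /andP[_ +] := weighted_sols_bounds (N + C) all_bs; rewrite size_bs addnA.
Qed.

End Bounds.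

(** Coordinate [i] of the vectors [b_r] solves the recurrence whose input is
    [1] at rank [i] and [0] elsewhere. *)
Lemma window_weight_unit_vec (R : realType) (k n : nat) (hk : (3 <= k)%N)
  (b : nat -> 'cV[R]_n)
  (hb1 : b 1%N = unit_vec R n 1)
  (hb2 : forall r : nat, (2 <= r <= k - 1)%N ->
     b r = unit_vec R n r + b (r - 1)%N)
  (hbk : forall r : nat, (k <= r <= n)%N ->
     b r = unit_vec R n r + \sum_(1 <= u < k) b (r - u)%N) (i : 'I_n) :
  (\sum_(1 <= r < n.+1) b r) i ord0 = (window_weight (window_start k) n i)%:R.
Proof.
have recb s : (s < n)%N ->
    b s.+1 = unit_vec R n s.+1 + \sum_(window_start k s <= l < s) b l.+1.
  move=> sn; rewrite /window_start; case: ltnP => sk.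
    case: s sk {sn} => [|s] sk /=; first by rewrite big_geq// addr0.
    by rewrite big_nat1 hb2 ?subn1//; lia.
  rewrite hbk; last by rewrite sn andbT; lia.
  congr (_ + _); case: k hk sk {hb2 hbk} => // k' _ /= sk.
  rewrite big_add1 /= [RHS]big_nat_rev/= -{1}[(s - k')%N]add0n big_addn subKn//.
  by apply: eq_big_nat => u /andP[_ uk]; congr (b _); lia.
have bE s : (s < n)%N ->
    b s.+1 i ord0 = (window_unit (window_start k) i s)%:~R.
  move=> sn; rewrite /window_unit (raddf_window_seq _ (intmul (1 : R))).
  move: s sn; apply: window_seq_uniq => s sn.
  rewrite recb// mxE summxE /= mxE eqSS eq_sym.
  by case: eqP.
rewrite big_add1 /= summxE big_mkord.
under eq_bigr => s _ do rewrite bE//.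
by rewrite -(raddf_sum (intmul (1 : R))) -window_weightE.
Qed.

Theorem theorem1 (R : realType) (k n : nat) (hk : (3 <= k)%N) (hkn : (k <= n)%N)
  (b : nat -> 'cV[R]_n)
  (hb1 : b 1%N = unit_vec R n 1)
  (hb2 : forall r : nat, (2 <= r <= k - 1)%N ->
     b r = unit_vec R n r + b (r - 1)%N)
  (hbk : forall r : nat, (k <= r <= n)%N ->
     b r = unit_vec R n r + \sum_(1 <= u < k) b (r - u)%N)
  (beta : 'cV[R]_n)
  (hbeta : \sum_(1 <= r < n.+1) b r = beta)
  (d : measure_display) (T : measurableType d) (P : probability T R)
  (X : 'I_(n - 1) -> {RV P >-> R})
  (hindep : mutually_independent X)
  (hunif : forall i, uniform01 (X i)) :
  P [set w | forall A : {set 'I_n}, #|A| = k ->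
       ~ forms_polygon (fun j : 'I_n => piece_length (fun i => X i w) j) A]
  = ((n`!)%:R / \prod_(r < n) beta r ord0)%:E.
Proof.
have betaE := window_weight_unit_vec hk hb1 hb2 hbk.
rewrite (eq_bigr (fun r : 'I_n => (window_weight (window_start k) n r)%:R)); last first.
  by move=> r _; rewrite -hbeta betaE.
have nE : n = (n - 1).+1 by lia.
move: (n - 1)%N nE X hindep hunif => m nE X hindep hunif.
clear hb1 hb2 hbk hbeta betaE; subst n.
exact: (prob_no_polygonE (ltnW hk) hindep hunif).
Qed.
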